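(* Let $\mathcal V$ be a commutative unital quantale and let $\mathbb X$ be a (small) transitive $\mathcal V$-metagory. Then the unit $\mathbb X\to\mathsf{Path}\,\mathbb X$ at $\mathbb X$ of the right-adjoint functor $\mathbf{Met}_{\mathcal V}\text{-}\mathbf{Cat}\to\mathbf{Metag}_{\mathcal V}$ (the induced $\mathcal V$-area functor) is an isometry.
   Context: A commutative unital quantale $\mathcal V=(\mathcal V,\leq,\otimes,\mathsf k)$ is a complete lattice with a commutative, associative operation $\otimes$ with neutral element $\mathsf k$, preserving arbitrary suprema in each variable. A $\mathcal V$-metric space is a set $X$ with $d:X\times X\to\mathcal V$ such that $\mathsf k\leq d(x,x)$, $d(x,y)\leq d(y,x)$, $d(x,y)\otimes d(y,z)\leq d(x,z)$. A $\mathcal V$-metric category is a category whose hom-sets are $\mathcal V$-metric spaces with $d(f,f')\otimes d(g,g')\leq d(g\cdot f,g'\cdot f')$ for all $f,f':x\to y$, $g,g':y\to z$. $\mathbf{Met}_{\mathcal V}\text{-}\mathbf{Cat}$ is the category of small $\mathcal V$-metric categories and $\mathcal V$-contractive functors, i.e. functors with $d(f,f')\leq d(Ff,Ff')$ for parallel $f,f'$. A $\mathcal V$-metagory $\mathbb X$ consists of: a class of objects (small if it is a set); pairwise disjoint hom-sets $\mathbb X(x,y)$ of morphisms (no composition); a distinguished $1_x\in\mathbb X(x,x)$ for each $x$; and functions $\delta:\mathbb X(x,y)\times\mathbb X(y,z)\times\mathbb X(x,z)\to\mathcal V$ such that $\mathsf k\leq\delta(1_x,f,f)$, $\mathsf k\leq\delta(f,1_y,f)$,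 $\delta(f,g,a)\otimes\delta(g,h,b)\otimes\delta(f,b,c)\leq\delta(a,h,c)$, $\delta(f,g,a)\otimes\delta(g,h,b)\otimes\delta(a,h,c)\leq\delta(f,b,c)$ for all $f:x\to y$, $g:y\to z$, $h:z\to w$, $a:x\to z$, $b:y\to w$, $c:x\to w$. A $\mathcal V$-contractor $F:\mathbb X\to\mathbb Y$ is a graph morphism with $F(1_x)=1_{Fx}$ and $\delta_{\mathbb X}(f,g,a)\leq\delta_{\mathbb Y}(Ff,Fg,Fa)$; it is an isometry if equality always holds. $\mathbf{Metag}_{\mathcal V}$ is the category of small $\mathcal V$-metagories and $\mathcal V$-contractors. $\mathbb X$ is transitive if for all $f:x\to y$, $g:y\to z$, $h:z\to w$, $c:x\to w$: $\delta(f,b,c)\otimes\delta(g,h,b)\leq\bigvee_{a:x\to z}\delta(f,g,a)\otimes\delta(a,h,c)$ for all $b:y\to w$, and $\delta(f,g,a)\otimes\delta(a,h,c)\leq\bigvee_{b:y\to w}\delta(f,b,c)\otimes\delta(g,h,b)$ for all $a:x\to z$. The induced $\mathcal V$-area functor $\mathbf{Met}_{\mathcal V}\text{-}\mathbf{Cat}\to\mathbf{Metag}_{\mathcal V}$ sends a $\mathcal V$-metric category to the $\mathcal V$-metagory on its underlying graph with the same identities and $\delta(f,g,a)=d(g\cdot f,a)$, and is identical on morphisms. It has a left adjoint, whose value at $\mathbb X$ is denoted $\mathsf{Path}\,\mathbb X$ (the free $\mathcal V$-metric category over $\mathbb X$): its underlying category is the free category over the underlying graph of $\mathbb X$ (all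 paths, with the given morphisms $1_x$ identified with empty paths), and the unit $\mathbb X\to\mathsf{Path}\,\mathbb X$ is the insertion of morphisms as paths of length one. *)

(* Defs.v *)
From HB Require Import structures.
From mathcomp Require Import all_boot all_order.
From mathcomp Require Import boolp classical_sets.

Set Implicit Arguments.
Unset Strict Implicit.
Unset Printing Implicit Defensive.

Import Order.TTheory.

Declare Scope quantale_scope.
Delimit Scope quantale_scope with Q.
Local Open Scope classical_set_scope.
Local Open Scope order_scope.

(* Only preservation of suprema in the right variable is required, as the
   multiplication is commutative. Completeness is the existence of all suprema,
   including that of the empty set. *)
HB.mixin Record isComQuantale (d : Order.disp_t) (T : Type)
    of Order.POrder d T := {
  qsup : set T -> T;
  qmul : T -> T -> T;
  qunit : T;
  qsup_isLub : forall A : set T, isLub A (qsup A);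
  qmulA : associative qmul;
  qmulC : commutative qmul;
  qmul1q : left_id qunit qmul;
  qmul_sup : forall (a : T) (A : set T),
    qmul a (qsup A) = qsup [set qmul a b | b in A]
}.

#[short(type="comQuantaleType")]
HB.structure Definition ComQuantale (d : Order.disp_t) :=
  { T of isComQuantale d T & Order.POrder d T }.

Notation "a ⊗ b" := (qmul a b) (at level 40, left associativity)
  : quantale_scope.
Local Open Scope quantale_scope.

Definition qinf (disp : Order.disp_t) (V : comQuantaleType disp) (A : set V) : V :=
  qsup (lbound A).

Section Quantale.
Context (disp : Order.disp_t) (V : comQuantaleType disp).
Implicit Types (a b c : V) (A : set V).

Lemma qsup_ub A a : A a -> a <= qsup A.
Proof. by have [ub _] := qsup_isLub A; exact: ub. Qed.

Lemma qsup_le A b : (forall a, A a -> a <= b) -> qsup A <= b.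
Proof. by have [_ lub] := qsup_isLub A; exact: lub. Qed.

Lemma qinf_lb A a : A a -> qinf A <= a.
Proof. by move=> Aa; apply: qsup_le => b; exact. Qed.

Lemma qinf_ge A b : (forall a, A a -> b <= a) -> b <= qinf A.
Proof. by move=> bA; apply: qsup_ub. Qed.

Lemma qmul_le2l a b c : b <= c -> a ⊗ b <= a ⊗ c.
Proof.
move=> bc; have -> : c = qsup [set b; c].
  apply/le_anti/andP; split; first by apply: qsup_ub; right.
  by apply: qsup_le => _ [] ->.
by rewrite qmul_sup; apply: qsup_ub; exists b => //; left.
Qed.

Lemma qmul_le2 a a' b b' : a <= a' -> b <= b' -> a ⊗ b <= a' ⊗ b'.
Proof.
move=> aa' bb'; apply: (le_trans (qmul_le2l a bb')).
by rewrite (qmulC a) (qmulC a'); exact: qmul_le2l.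
Qed.
End Quantale.

Record category := Category {
  ob :> Type;
  hom : ob -> ob -> Type;
  idm : forall x, hom x x;
  comp : forall x y z, hom y z -> hom x y -> hom x z;
  comp1m : forall x y (f : hom x y), comp (idm y) f = f;
  compm1 : forall x y (f : hom x y), comp f (idm x) = f;
  compA : forall x y z w (f : hom x y) (g : hom y z) (h : hom z w),
    comp h (comp g f) = comp (comp h g) f
}.

Arguments idm {c} x.

Record is_metric (disp : Order.disp_t) (V : comQuantaleType disp) (T : Type)
    (d : T -> T -> V) : Prop := IsMetric {
  metric_refl : forall x, qunit <= d x x;
  metric_sym : forall x y, d x y <= d y x;
  metric_trans : forall x y z, d x y ⊗ d y z <= d x z
}.

Record is_metric_category (disp : Order.disp_t) (V : comQuantaleType disp)
    (C : category) (d : forall x y : C, hom x y -> hom x y -> V) : Prop :=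
  IsMetricCategory {
  metric_hom : forall x y : C, is_metric (d x y);
  metric_comp : forall (x y z : C) (f f' : hom x y) (g g' : hom y z),
    d x y f f' ⊗ d y z g g' <= d x z (comp g f) (comp g' f')
}.

Record metricCategory (disp : Order.disp_t) (V : comQuantaleType disp) :=
  MetricCategory {
  mcat :> category;
  dist : forall x y : mcat, hom x y -> hom x y -> V;
  distP : is_metric_category dist
}.

Record contractiveFunctor (disp : Order.disp_t) (V : comQuantaleType disp)
    (C D : metricCategory V) := ContractiveFunctor {
  fobj :> C -> D;
  fhom : forall x y : C, hom x y -> hom (fobj x) (fobj y);
  fhom_id : forall x : C, fhom (idm x) = idm (fobj x);
  fhom_comp : forall (x y z : C) (f : hom x y) (g : hom y z),
    fhom (comp g f) = comp (fhom g) (fhom f);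
  fhom_contractive : forall (x y : C) (f f' : hom x y),
    dist f f' <= dist (fhom f) (fhom f')
}.

Record metagory (disp : Order.disp_t) (V : comQuantaleType disp) := Metagory {
  mob :> Type;
  mhom : mob -> mob -> Type;
  mid : forall x, mhom x x;
  area : forall x y z, mhom x y -> mhom y z -> mhom x z -> V;
  area_1l : forall x y (f : mhom x y), qunit <= area (mid x) f f;
  area_1r : forall x y (f : mhom x y), qunit <= area f (mid y) f;
  area_assocl : forall x y z w (f : mhom x y) (g : mhom y z) (h : mhom z w)
      (a : mhom x z) (b : mhom y w) (c : mhom x w),
    area f g a ⊗ area g h b ⊗ area f b c <= area a h c;
  area_assocr : forall x y z w (f : mhom x y) (g : mhom y z) (h : mhom z w)
      (a : mhom x z) (b : mhom y w) (c : mhom x w),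
    area f g a ⊗ area g h b ⊗ area a h c <= area f b c
}.

Arguments mid {disp V m} x.

Record contractor (disp : Order.disp_t) (V : comQuantaleType disp)
    (X Y : metagory V) := Contractor {
  cobj :> X -> Y;
  chom : forall x y : X, mhom x y -> mhom (cobj x) (cobj y);
  chom_id : forall x : X, chom (mid x) = mid (cobj x);
  chom_contractive : forall (x y z : X) (f : mhom x y) (g : mhom y z)
      (a : mhom x z),
    area f g a <= area (chom f) (chom g) (chom a)
}.

Definition is_isometry (disp : Order.disp_t) (V : comQuantaleType disp)
    (X Y : metagory V) (F : contractor X Y) : Prop :=
  forall (x y z : X) (f : mhom x y) (g : mhom y z) (a : mhom x z),
    area f g a = area (chom F f) (chom F g) (chom F a).

Definition comp_contractor (disp : Order.disp_t) (V : comQuantaleType disp)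
    (X Y Z : metagory V) (G : contractor Y Z) (F : contractor X Y) :
  contractor X Z.
Proof.
apply: (@Contractor _ V X Z (fun x => G (F x))
  (fun x y f => chom G (chom F f))) => [x|x y z f g a].
- by rewrite !chom_id.
- exact: le_trans (chom_contractive F f g a) (chom_contractive G _ _ _).
Defined.

Definition transitive_metagory (disp : Order.disp_t) (V : comQuantaleType disp)
    (X : metagory V) : Prop :=
  forall (x y z w : X) (f : mhom x y) (g : mhom y z) (h : mhom z w)
    (c : mhom x w),
  (forall b : mhom y w,
     area f b c ⊗ area g h b <=
       qsup (range (fun a : mhom x z => area f g a ⊗ area a h c))) /\
  (forall a : mhom x z,
     area f g a ⊗ area a h c <=
       qsup (range (fun b : mhom y w => area f b c ⊗ area g h b))).

Section AreaFunctor.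
Context (disp : Order.disp_t) (V : comQuantaleType disp).

Section Objects.
Context (C : metricCategory V).

Definition induced_area (x y z : C) (f : hom x y) (g : hom y z) (a : hom x z) : V :=
  dist (comp g f) a.

Lemma induced_area_1l (x y : C) (f : hom x y) : qunit <= induced_area (idm x) f f.
Proof. by rewrite /induced_area compm1; exact: metric_refl (metric_hom (distP C) _ _) _. Qed.

Lemma induced_area_1r (x y : C) (f : hom x y) : qunit <= induced_area f (idm y) f.
Proof. by rewrite /induced_area comp1m; exact: metric_refl (metric_hom (distP C) _ _) _. Qed.

Let dist_refl (x y : C) (f : hom x y) : qunit <= dist f f.
Proof. exact: metric_refl (metric_hom (distP C) x y) f. Qed.

Let dist_trans (x y : C) (f g h : hom x y) : dist f g ⊗ dist g h <= dist f h.
Proof. exact: metric_trans (metric_hom (distP C) x y) f g h. Qed.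

Let dist_sym (x y : C) (f g : hom x y) : dist f g <= dist g f.
Proof. exact: metric_sym (metric_hom (distP C) x y) f g. Qed.

Let dist_compl (x y z : C) (f f' : hom x y) (g : hom y z) :
  dist f f' <= dist (comp g f) (comp g f').
Proof.
rewrite -[leLHS]qmul1q qmulC.
exact: le_trans (qmul_le2l _ (dist_refl g)) (metric_comp (distP C) f f' g g).
Qed.

Let dist_compr (x y z : C) (f : hom x y) (g g' : hom y z) :
  dist g g' <= dist (comp g f) (comp g' f).
Proof.
rewrite -[leLHS]qmul1q.
apply: le_trans (metric_comp (distP C) f f g g').
exact: qmul_le2.
Qed.

Lemma induced_area_assocl (x y z w : C) (f : hom x y) (g : hom y z)
    (h : hom z w) (a : hom x z) (b : hom y w) (c : hom x w) :
  induced_area f g a ⊗ induced_area g h b ⊗ induced_area f b c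
    <= induced_area a h c.
Proof.
rewrite /induced_area; apply: le_trans (dist_trans _ (comp b f) _).
apply: qmul_le2 => //; apply: le_trans (dist_trans _ (comp h (comp g f)) _).
apply: qmul_le2; first exact: le_trans (dist_sym _ _) (dist_compl _ _ _).
by rewrite compA; exact: dist_compr.
Qed.

Lemma induced_area_assocr (x y z w : C) (f : hom x y) (g : hom y z)
    (h : hom z w) (a : hom x z) (b : hom y w) (c : hom x w) :
  induced_area f g a ⊗ induced_area g h b ⊗ induced_area a h c
    <= induced_area f b c.
Proof.
rewrite /induced_area; apply: le_trans (dist_trans _ (comp h a) _).
apply: qmul_le2 => //; apply: le_trans (dist_trans _ (comp h (comp g f)) _).
rewrite qmulC; apply: qmul_le2; last exact: dist_compl.
by rewrite compA; apply: le_trans (dist_sym _ _) (dist_compr _ _ _).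
Qed.

Definition area_metagory : metagory V :=
  {| area_1l := induced_area_1l; area_1r := induced_area_1r;
     area_assocl := induced_area_assocl; area_assocr := induced_area_assocr |}.
End Objects.

Definition area_contractor (C D : metricCategory V)
    (F : contractiveFunctor C D) :
  contractor (area_metagory C) (area_metagory D).
Proof.
apply: (@Contractor _ V (area_metagory C) (area_metagory D) F (fhom F))
  => [x|x y z f g a].
- exact: fhom_id.
- rewrite /= /induced_area -fhom_comp; exact: fhom_contractive.
Defined.
End AreaFunctor.

Section Path.
Context (disp : Order.disp_t) (V : comQuantaleType disp) (X : metagory V).

Inductive is_mid (x : X) : forall y : X, mhom x y -> Prop :=
  IsMid : is_mid (mid x).

(* Paths in normal form: identifying every [mid x] with the empty path at [x]
   amounts to considering the paths none of whose steps is an identity. *)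
Inductive npath (x : X) : X -> Type :=
| path_nil : npath x x
| path_snoc y z (p : npath x y) (f : mhom y z) : ~ is_mid f -> npath x z.

Fixpoint path_cat (x y z : X) (q : npath y z) (p : npath x y) : npath x z :=
  match q with
  | path_nil => p
  | path_snoc _ _ q' f nf => path_snoc (path_cat q' p) nf
  end.

Lemma path_cat1p (x y : X) (p : npath x y) : path_cat (path_nil y) p = p.
Proof. by []. Qed.

Lemma path_catp1 (x y : X) (p : npath x y) : path_cat p (path_nil x) = p.
Proof. by elim: p => //= u v p IH f nf; rewrite IH. Qed.

Lemma path_catA (x y z w : X) (p : npath x y) (q : npath y z) (r : npath z w) :
  path_cat r (path_cat q p) = path_cat (path_cat r q) p.
Proof. by elim: r q => //= u v r IH f nf q; rewrite IH. Qed.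

Definition path_category : category := Category path_cat1p path_catp1 path_catA.

(* The path of length one, or the empty path if [f] is an identity. *)
Definition path_of (x y : X) (f : mhom x y) : npath x y :=
  match pselect (is_mid f) with
  | left h => match h in @is_mid _ y _ return npath x y with
              | IsMid => path_nil x
              end
  | right nf => path_snoc (path_nil x) nf
  end.

Lemma path_of_mid (x : X) : path_of (mid x) = path_nil x.
Proof.
rewrite /path_of; case: pselect => [h|/(_ (IsMid x))//].
by rewrite (Prop_irrelevance h (IsMid x)).
Qed.

Lemma path_of_nmid (x y : X) (f : mhom x y) (nf : ~ is_mid f) :
  path_of f = path_snoc (path_nil x) nf.
Proof.
rewrite /path_of; case: pselect => // nf'.
by rewrite (Prop_irrelevance nf nf').
Qed.

(* The metrics on the path category for which [path_of] is a contractor; the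
   free metric is the least of them. *)
Record path_metric (d : forall x y : path_category, hom x y -> hom x y -> V) :
  Prop := PathMetric {
  path_metric_category : is_metric_category d;
  path_metric_area : forall (x y z : X) (f : mhom x y) (g : mhom y z)
      (a : mhom x z),
    area f g a <= d x z (path_cat (path_of g) (path_of f)) (path_of a)
}.

Definition path_dist (x y : path_category) (p q : hom x y) : V :=
  qinf [set d x y p q | d in path_metric].

Lemma path_dist_metric : path_metric path_dist.
Proof.
split; last first.
  move=> x y z f g a; apply: qinf_ge => _ [d dP <-].
  exact: path_metric_area dP _ _ _ _ _ _.
split=> [x y|x y z f f' g g']; last first.
  apply: qinf_ge => _ [d dP <-].
  apply: le_trans (metric_comp (path_metric_category dP) f f' g g').
  by apply: qmul_le2; apply: qinf_lb; exists d.
split=> [p|p q|p q r]; apply: qinf_ge => _ [d dP <-];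
  have [dr ds dt] := metric_hom (path_metric_category dP) x y.
- exact: dr.
- by apply: le_trans (ds _ _); apply: qinf_lb; exists d.
- by apply: le_trans (dt _ q _); apply: qmul_le2; apply: qinf_lb; exists d.
Qed.

Definition Path : metricCategory V :=
  MetricCategory (path_metric_category path_dist_metric).

Definition path_unit : contractor X (area_metagory Path) :=
  @Contractor _ V X (area_metagory Path) id path_of path_of_mid
    (path_metric_area path_dist_metric).

Section Lift.
Context (C : metricCategory V) (F : contractor X (area_metagory C)).

Fixpoint path_lift (x y : X) (p : npath x y) : hom (F x : C) (F y) :=
  match p with
  | path_nil => idm (F x : C)
  | path_snoc _ _ p' f _ => @comp C _ _ _ (chom F f) (path_lift p')
  end.

Lemma path_lift_of (x y : X) (f : mhom x y) : path_lift (path_of f) = chom F f.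
Proof.
case: (pselect (is_mid f)) => [|nf].
  by case: y f / => /=; rewrite path_of_mid chom_id.
by rewrite path_of_nmid /=; exact: compm1.
Qed.

Lemma path_lift_cat (x y z : X) (p : npath x y) (q : npath y z) :
  path_lift (path_cat q p) = comp (path_lift q) (path_lift p).
Proof.
elim: q p => [p|u v q IH f nf p] /=; first by rewrite comp1m.
by rewrite IH compA.
Qed.

Lemma path_lift_metric :
  path_metric (fun x y p q => dist (path_lift p) (path_lift q)).
Proof.
split=> [|x y z f g a]; last first.
  by rewrite path_lift_cat !path_lift_of; exact: (chom_contractive F f g a).
split=> [x y|x y z f f' g g'] /=; last first.
  rewrite !path_lift_cat; exact: metric_comp (distP C) _ _ _ _ _ _ _.
have [dr ds dt] := metric_hom (distP C) (F x) (F y).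
by split=> *; [exact: dr|exact: ds|exact: dt].
Qed.

Lemma path_lift_contractive (x y : X) (p q : npath x y) :
  path_dist p q <= dist (path_lift p) (path_lift q).
Proof. by apply: qinf_lb; eexists; first exact: path_lift_metric. Qed.

Definition path_functor : contractiveFunctor Path C :=
  @ContractiveFunctor _ V Path C F path_lift (fun=> erefl) path_lift_cat
    path_lift_contractive.
End Lift.

Lemma contractor_eq (Y Z : metagory V) (o : Y -> Z)
    (m m' : forall x y : Y, mhom x y -> mhom (o x) (o y)) i i' c c' :
  (forall x y (f : mhom x y), m x y f = m' x y f) ->
  @Contractor _ V Y Z o m i c = @Contractor _ V Y Z o m' i' c'.
Proof.
move=> mm'; have {}mm' : m = m'.
  by do 3 (apply: functional_extensionality_dep => ?); exact: mm'.
case: m' / mm' i' c' => i' c'.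
by rewrite (Prop_irrelevance i i') (Prop_irrelevance c c').
Qed.

Lemma contractiveFunctor_eq (C D : metricCategory V) (o : C -> D)
    (m m' : forall x y : C, hom x y -> hom (o x) (o y)) i i' k k' c c' :
  (forall x y (f : hom x y), m x y f = m' x y f) ->
  @ContractiveFunctor _ V C D o m i k c = @ContractiveFunctor _ V C D o m' i' k' c'.
Proof.
move=> mm'; have {}mm' : m = m'.
  by do 3 (apply: functional_extensionality_dep => ?); exact: mm'.
case: m' / mm' i' k' c' => i' k' c'.
by rewrite (Prop_irrelevance i i') (Prop_irrelevance k k')
  (Prop_irrelevance c c').
Qed.

Lemma path_functor_unique (C : metricCategory V)
    (F : contractor X (area_metagory C)) (G : contractiveFunctor Path C) :
  comp_contractor (area_contractor G) path_unit = F -> path_functor F = G.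
Proof.
move=> <-; case: G => o m i k c.
apply: contractiveFunctor_eq => x y p /=.
elim: p => /= [|u v p IH f nf]; first by rewrite -i.
rewrite IH -k; congr (m _ _ _).
by rewrite /= path_of_nmid.
Qed.

(* [path_unit] is a universal arrow from [X] to the induced area functor: it is
   the unit at [X] of its left adjoint, whose value at [X] is [Path]. *)
Theorem path_unit_universal (C : metricCategory V)
    (F : contractor X (area_metagory C)) :
  exists! G : contractiveFunctor Path C,
    comp_contractor (area_contractor G) path_unit = F.
Proof.
exists (path_functor F); split=> [|G]; last exact: path_functor_unique.
case: F => o m i c; apply: contractor_eq => x y f /=.
exact: (@path_lift_of C (@Contractor _ V X (area_metagory C) o m i c)).
Qed.
End Path.

(* Main.v *)
(** Extend the area to a value [filling p c] for a path [p] and a parallel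
    morphism [c] by [filling (p, h) c = sup_a filling p a ⊗ area a h c].
    Transitivity makes this independent of the bracketing, that is,
    [filling (p, q) c = sup_(a, b) filling p a ⊗ filling q b ⊗ area a b c].
    Comparing two paths through their fillings (a symmetrised Yoneda metric)
    therefore gives a metric category for which the unit is a contractor, so it
    bounds the free metric from above; evaluated at [(f, g)] and [a] it is at most
    [area f g a], because [a] fills itself. *)
Require Import Defs.
From mathcomp Require Import all_boot all_order.
From mathcomp Require Import boolp classical_sets.

Set Implicit Arguments.
Unset Strict Implicit.
Unset Printing Implicit Defensive.

Import Order.TTheory.

Local Open Scope classical_set_scope.
Local Open Scope order_scope.
Local Open Scope quantale_scope.

Section QuantaleTheory.
Context (disp : Order.disp_t) (V : comQuantaleType disp).
Implicit Types (a b c u v : V) (A : set V).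

Lemma qmulq1 a : a ⊗ qunit = a.
Proof. by rewrite qmulC qmul1q. Qed.

Lemma qmulAC a b c : a ⊗ b ⊗ c = a ⊗ c ⊗ b.
Proof. by rewrite -!qmulA (qmulC b). Qed.

Lemma qmulCA a b c : a ⊗ (b ⊗ c) = b ⊗ (a ⊗ c).
Proof. by rewrite !qmulA (qmulC a). Qed.

Lemma qmul_le_unitl u a : qunit <= u -> a <= u ⊗ a.
Proof. by move=> u1; rewrite -[leLHS]qmul1q; exact: qmul_le2. Qed.

Lemma qmul_le_unitr u a : qunit <= u -> a <= a ⊗ u.
Proof. by rewrite qmulC; exact: qmul_le_unitl. Qed.

Lemma qmul_qsup_le a A c :
  (forall b, A b -> a ⊗ b <= c) -> a ⊗ qsup A <= c.
Proof. by move=> h; rewrite qmul_sup; apply: qsup_le => _ [b Ab <-]; exact: h. Qed.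

Lemma qsup_mul_le a A c :
  (forall b, A b -> b ⊗ a <= c) -> qsup A ⊗ a <= c.
Proof.
by move=> h; rewrite qmulC; apply: qmul_qsup_le => b /h; rewrite qmulC.
Qed.
End QuantaleTheory.

Section Metagory.
Context (disp : Order.disp_t) (V : comQuantaleType disp) (X : metagory V).

(** Associativity at [mid x], [a], [mid y]: the two inner triangles are degenerate. The common value
    acts as the distance from [a] to [c]. *)
Lemma area_mid_swap (x y : X) (a c : mhom x y) :
  area (mid x) a c = area a (mid y) c.
Proof.
apply/le_anti/andP; split.
- apply: le_trans (area_assocl (mid x) a (mid y) a a c).
  by apply: qmul_le_unitl; rewrite -[leLHS]qmul1q;
    apply: qmul_le2; [exact: area_1l|exact: area_1r].
- apply: le_trans (area_assocr (mid x) a (mid y) a a c).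
  by apply: qmul_le_unitl; rewrite -[leLHS]qmul1q;
    apply: qmul_le2; [exact: area_1l|exact: area_1r].
Qed.

Lemma area_third (x y z : X) (f : mhom x y) (g : mhom y z) (a c : mhom x z) :
  area f g a ⊗ area a (mid z) c <= area f g c.
Proof.
apply: le_trans (area_assocr f g (mid z) a g c).
by apply: qmul_le2 => //; apply: qmul_le_unitr; exact: area_1r.
Qed.

Lemma area_third_dist (x y z : X) (f : mhom x y) (g : mhom y z)
    (a c : mhom x z) : area f g a ⊗ area f g c <= area a (mid z) c.
Proof.
apply: le_trans (area_assocl f g (mid z) a g c).
by apply: qmul_le2 => //; apply: qmul_le_unitr; exact: area_1r.
Qed.

Lemma area_first (x y z : X) (f a : mhom x y) (g : mhom y z) (c : mhom x z) :
  area f (mid y) a ⊗ area a g c <= area f g c.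
Proof.
apply: le_trans (area_assocr f (mid y) g a g c).
by apply: qmul_le2 => //; apply: qmul_le_unitr; exact: area_1l.
Qed.

Lemma area_second (x y z : X) (f : mhom x y) (g b : mhom y z) (c : mhom x z) :
  area (mid y) g b ⊗ area f b c <= area f g c.
Proof.
apply: le_trans (area_assocl f (mid y) g f b c).
by apply: qmul_le2 => //; apply: qmul_le_unitl; exact: area_1r.
Qed.

(** The base case is the distance from [mid x] to the filler. *)
Fixpoint filling (x y : X) (p : npath x y) : mhom x y -> V :=
  match p with
  | path_nil => area (mid x) (mid x)
  | path_snoc _ _ q h _ =>
      fun c => qsup (range (fun a => filling q a ⊗ area a h c))
  end.

Lemma filling_snoc_ge (x y z : X) (p : npath x y) (h : mhom y z)
    (nh : ~ is_mid h) (a : mhom x y) (c : mhom x z) :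
  filling p a ⊗ area a h c <= filling (path_snoc p nh) c.
Proof. by apply: qsup_ub; exists a. Qed.

Lemma filling_trans (x y : X) (p : npath x y) (a c : mhom x y) :
  filling p a ⊗ area a (mid y) c <= filling p c.
Proof.
case: p a c => [a c|u v p h nh a c]; first exact: area_third.
apply: qsup_mul_le => _ [b _ <-].
apply: le_trans (filling_snoc_ge p nh b c).
by rewrite -qmulA; apply: qmul_le2 => //; exact: area_third.
Qed.

(** If [h] is not an identity, the supremum is attained at [mid x]. *)
Lemma filling_path_of (x y : X) (h c : mhom x y) :
  filling (path_of h) c = area (mid x) h c.
Proof.
case: (pselect (is_mid h)) => [ih|nh].
  by case: y h / ih c => c; rewrite path_of_mid.
rewrite path_of_nmid; apply/le_anti/andP; split.
  by apply: qsup_le => _ [a _ <-]; exact: area_first.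
apply: le_trans (filling_snoc_ge _ _ (mid x) c).
by apply: qmul_le_unitl; exact: area_1l.
Qed.

Section Transitive.
Hypothesis hX : transitive_metagory X.

(** Induction on [q]: the first half of transitivity trades joining [b'] with [h] first for joining
    [a] with [b'] first. *)
Lemma filling_cat_ge (x y z : X) (p : npath x y) (q : npath y z)
    (a : mhom x y) (b : mhom y z) (c : mhom x z) :
  filling p a ⊗ filling q b ⊗ area a b c <= filling (path_cat q p) c.
Proof.
elim: q p a b c => [|u v q IH h nh] p a b c /=.
  apply: le_trans (filling_trans p a c).
  by rewrite -qmulA; apply: qmul_le2 => //; exact: area_second.
rewrite qmulAC; apply: qmul_qsup_le => _ [b' _ <-].
rewrite qmulA (qmulAC (filling p a)) -qmulA.
have [/(_ b) hb _] := hX a b' h c.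
apply: le_trans (qmul_le2l _ hb) _.
apply: qmul_qsup_le => _ [a' _ <-]; rewrite qmulA.
by apply: le_trans (qmul_le2 (IH p a b' a') (lexx _)) (filling_snoc_ge _ nh a' c).
Qed.

(** The converse bound, from the second half of transitivity. Quantifying over [v] replaces a
    supremum over pairs [(a, b)]. *)
Lemma filling_cat_le (x y z : X) (p : npath x y) (q : npath y z)
    (c : mhom x z) (v : V) :
  (forall a b, filling p a ⊗ filling q b ⊗ area a b c <= v) ->
  filling (path_cat q p) c <= v.
Proof.
elim: q p c v => [|u w q IH h nh] p c v /= le_v.
  apply: le_trans (le_v c (mid y)); rewrite -qmulA.
  apply: qmul_le_unitr; rewrite -[leLHS]qmul1q.
  by apply: qmul_le2; [exact: area_1l|exact: area_1r].
(* The supremum is bounded through the residual [sup {u | u ⊗ area a' h c <= v}],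
   so that the induction hypothesis applies to [filling (path_cat q p) a']. *)
apply: qsup_le => _ [a' _ <-].
pose res := qsup [set t | t ⊗ area a' h c <= v].
apply: (@le_trans _ _ (res ⊗ area a' h c)); last exact: qsup_mul_le.
apply: qmul_le2 => //; apply: IH => a b'; apply: qsup_ub => /=.
have [_ /(_ a') ha] := hX a b' h c.
rewrite -qmulA; apply: le_trans (qmul_le2l _ ha) _.
apply: qmul_qsup_le => _ [b _ <-].
apply: le_trans (le_v a b); rewrite (qmulC (area a b c)) qmulA.
apply: qmul_le2 => //; rewrite -qmulA.
by apply: qmul_le2 => //; exact: filling_snoc_ge.
Qed.

(** Among all pairs of fillers, [f] and [g] themselves are optimal, by [area_first] and
    [area_second]. *)
Lemma filling_path_of2 (x y z : X) (f : mhom x y) (g : mhom y z)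
    (c : mhom x z) :
  filling (path_cat (path_of g) (path_of f)) c = area f g c.
Proof.
apply/le_anti/andP; split.
  apply: filling_cat_le => a b; rewrite !filling_path_of -qmulA.
  rewrite (area_mid_swap f a); apply: le_trans (area_first f a g c).
  by apply: qmul_le2 => //; exact: area_second.
apply: le_trans (filling_cat_ge _ _ f g c); rewrite !filling_path_of.
apply: qmul_le_unitl; rewrite -[leLHS]qmul1q.
by apply: qmul_le2; exact: area_1l.
Qed.

Definition filling_dist (x y : path_category X) (p q : hom x y) : V :=
  qsup [set v | forall c : mhom x y,
    v ⊗ filling p c <= filling q c /\ v ⊗ filling q c <= filling p c].

(** As [⊗] preserves suprema, the supremum [filling_dist p q] satisfies the inequalities that define
    its set. *)
Lemma filling_distl (x y : path_category X) (p q : hom x y) (c : mhom x y) :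
  filling_dist p q ⊗ filling p c <= filling q c.
Proof. by apply: qsup_mul_le => v /(_ c)[]. Qed.

Lemma filling_distr (x y : path_category X) (p q : hom x y) (c : mhom x y) :
  filling_dist p q ⊗ filling q c <= filling p c.
Proof. by apply: qsup_mul_le => v /(_ c)[]. Qed.

Lemma filling_dist_metric_category : is_metric_category filling_dist.
Proof.
split=> [x y|x y z f f' g g'].
  split=> [p|p q|p q r].
  - by apply: qsup_ub => c; rewrite qmul1q.
  - by apply: qsup_ub => c; split; [exact: filling_distr|exact: filling_distl].
  - apply: qsup_ub => c; split.
    + rewrite (qmulC (filling_dist p q)) -qmulA.
      exact: le_trans (qmul_le2l _ (filling_distl p q c)) (filling_distl q r c).
    + rewrite -qmulA.
      exact: le_trans (qmul_le2l _ (filling_distr q r c)) (filling_distr p q c).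
(* A one-sided estimate, to be used once in each direction. *)
have step (s t : V) (p p' : npath x y) (q q' : npath y z) (c : mhom x z) :
    (forall a, s ⊗ filling p a <= filling p' a) ->
    (forall b, t ⊗ filling q b <= filling q' b) ->
    s ⊗ t ⊗ filling (path_cat q p) c <= filling (path_cat q' p') c.
  move=> hs ht; pose v := filling (path_cat q' p') c; rewrite -/v.
  (* [filling_cat_le] bounds a bare filling, so the factor [s ⊗ t] is moved to the other side as a
     residual. *)
  pose res := qsup [set u | s ⊗ t ⊗ u <= v].
  apply: (@le_trans _ _ (s ⊗ t ⊗ res)); last exact: qmul_qsup_le.
  apply: qmul_le2 => //; apply: filling_cat_le => a b; apply: qsup_ub => /=.
  apply: le_trans (filling_cat_ge p' q' a b c).
  rewrite qmulA; apply: qmul_le2 => //.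
  by rewrite -qmulA (qmulCA t) qmulA; exact: qmul_le2.
apply: qsup_ub => c; split; apply: step => *;
  by [exact: filling_distl|exact: filling_distr].
Qed.

(** Once the fillings of [(f, g)] and [a] are computed as areas, [area f g a] meets both conditions
    of [filling_dist] by the tetrahedron inequalities. *)
Lemma filling_dist_path_metric : path_metric filling_dist.
Proof.
split=> [|x y z f g a]; first exact: filling_dist_metric_category.
apply: qsup_ub => c; rewrite filling_path_of2 filling_path_of area_mid_swap.
by split; [exact: area_third_dist|exact: area_third].
Qed.

Lemma filling_dist_le_area (x y z : X) (f : mhom x y) (g : mhom y z)
    (a : mhom x z) :
  filling_dist (path_cat (path_of g) (path_of f)) (path_of a) <= area f g a.
Proof.
rewrite -(filling_path_of2 f g a).
apply: le_trans (filling_distr _ (path_of a) a).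
by apply: qmul_le_unitr; rewrite filling_path_of; exact: area_1l.
Qed.
End Transitive.
End Metagory.

Theorem corollary7p7 (disp : Order.disp_t) (V : comQuantaleType disp)
    (X : metagory V) (hX : transitive_metagory X) :
  is_isometry (path_unit X).
Proof.
move=> x y z f g a; apply/le_anti/andP; split; first exact: chom_contractive.
apply: le_trans (filling_dist_le_area hX f g a).
by apply: qinf_lb; exists (@filling_dist _ V X) => //;
  exact: filling_dist_path_metric.
Qed.
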